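(* There exist a $C^*$-algebra $A$, a Hilbert $A$-module $H$ and two projections $P,Q\in\mathcal{L}(H)$ such that $$\mathcal{R}(P)\cap\mathcal{R}(Q)=\mathcal{R}(P)\cap\mathcal{N}(Q)=\mathcal{N}(P)\cap\mathcal{R}(Q)=\mathcal{N}(P)\cap\mathcal{N}(Q)=\{0\},$$ and none of the four closed submodules $$\overline{\mathcal{R}(P+Q)},\quad\overline{\mathcal{R}(P+I-Q)},\quad\overline{\mathcal{R}(I-P+Q)},\quad\overline{\mathcal{R}(I-P+I-Q)}$$ is equal to $H$; consequently none of these four submodules is orthogonally complemented in $H$.
   Context: $\mathcal{L}(H)$ is the $C^*$-algebra of adjointable operators on the Hilbert $A$-module $H$; a projection is $P\in\mathcal{L}(H)$ with $P=P^2=P^*$; $\mathcal{R}$ and $\mathcal{N}$ denote range and null space; $I$ is the identity operator. A closed submodule $M\subseteq H$ is orthogonally complemented in $H$ if $H=M+M^\perp$, where $M^\perp=\{x\in H:\langle x,y\rangle=0\ \forall y\in M\}$. *)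

(* Defs.v *)
From HB Require Import structures.
From mathcomp Require Import all_boot all_order all_algebra complex.
From mathcomp Require Import boolp classical_sets reals topology normedtype.

Set Implicit Arguments.
Unset Strict Implicit.
Unset Printing Implicit Defensive.

Import Order.TTheory GRing.Theory Num.Theory.
Import numFieldNormedType.Exports.

Local Open Scope classical_set_scope.
Local Open Scope ring_scope.
Local Open Scope complex_scope.

(* The norm of a normed module over R[i] takes its values in R[i] (it is a
   nonnegative real number seen as a complex number).  C*-algebras are not
   assumed to be unital, hence the multiplication is a separate operation
   instead of the one of a (unital) ring structure. *)
HB.mixin Record isCStarAlgebra (R : realType) A
    of CompleteNormedModule R[i] A := {
  cmul : A -> A -> A ;
  star : A -> A ;
  cmulA : forall a b c : A, cmul a (cmul b c) = cmul (cmul a b) c ;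
  cmulDl : forall a b c : A, cmul (a + b) c = cmul a c + cmul b c ;
  cmulDr : forall a b c : A, cmul a (b + c) = cmul a b + cmul a c ;
  cmulZl : forall (k : R[i]) (a b : A), cmul (k *: a) b = k *: cmul a b ;
  cmulZr : forall (k : R[i]) (a b : A), cmul a (k *: b) = k *: cmul a b ;
  ler_norm_cmul : forall a b : A, `|cmul a b| <= `|a| * `|b| ;
  starK : forall a : A, star (star a) = a ;
  starD : forall a b : A, star (a + b) = star a + star b ;
  starZ : forall (k : R[i]) (a : A), star (k *: a) = Num.conj k *: star a ;
  starM : forall a b : A, star (cmul a b) = cmul (star b) (star a) ;
  normC_star : forall a : A, `|cmul (star a) a| = `|a| ^+ 2
}.

#[short(type="cstarAlgType")]
HB.structure Definition CStarAlgebra (R : realType) :=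
  {A of CompleteNormedModule R[i] A & isCStarAlgebra R A}.

Definition cstar_pos (R : realType) (A : cstarAlgType R) (a : A) : Prop :=
  exists b : A, a = cmul (star b) b.

(* Right Hilbert A-modules, with an A-valued inner product that is linear in
   the second variable and conjugate-linear in the first one.  The norm is the
   one induced by the inner product, |x| = |<x, x>|^(1/2). *)
HB.mixin Record isHilbertModule (R : realType) (A : cstarAlgType R) H
    of CompleteNormedModule R[i] H := {
  ract : H -> A -> H ;
  inner : H -> H -> A ;
  ractDl : forall (x y : H) (a : A), ract (x + y) a = ract x a + ract y a ;
  ractDr : forall (x : H) (a b : A), ract x (a + b) = ract x a + ract x b ;
  ractA : forall (x : H) (a b : A), ract x (cmul a b) = ract (ract x a) b ;
  ractZl : forall (k : R[i]) (x : H) (a : A), ract (k *: x) a = k *: ract x a ;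
  ractZr : forall (k : R[i]) (x : H) (a : A), ract x (k *: a) = k *: ract x a ;
  innerDr : forall x y z : H, inner x (y + z) = inner x y + inner x z ;
  innerZr : forall (k : R[i]) (x y : H), inner x (k *: y) = k *: inner x y ;
  inner_ract : forall (x y : H) (a : A), inner x (ract y a) = cmul (inner x y) a ;
  inner_star : forall x y : H, inner y x = star (inner x y) ;
  inner_pos : forall x : H, cstar_pos (inner x x) ;
  inner_eq0 : forall x : H, inner x x = 0 -> x = 0 ;
  norm_inner : forall x : H, `|x| ^+ 2 = `|inner x x|
}.

#[short(type="hilbertModType")]
HB.structure Definition HilbertModule (R : realType) (A : cstarAlgType R) :=
  {H of CompleteNormedModule R[i] H & isHilbertModule R A H}.

Section HilbertModuleTheory.
Context {R : realType} {A : cstarAlgType R} {H : hilbertModType A}.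

Definition is_adjoint (T S : H -> H) : Prop :=
  forall x y : H, inner (T x) y = inner x (S y) :> A.

(* Membership in L(H); linearity and boundedness follow. *)
Definition adjointable (T : H -> H) : Prop := exists S : H -> H, is_adjoint T S.

Definition projection (P : H -> H) : Prop :=
  [/\ adjointable P, P \o P = P & is_adjoint P P].

Definition null_space (T : H -> H) : set H := [set x | T x = 0].

Definition orthogonal (M : set H) : set H :=
  [set x | forall y, M y -> inner x y = 0 :> A].

Definition orthogonally_complemented (M : set H) : Prop :=
  forall x : H, exists y z : H, [/\ M y, orthogonal M z & x = y + z].

End HilbertModuleTheory.

(* Main.v *)
Require Import Defs.
From HB Require Import structures.
From mathcomp Require Import all_boot all_order all_algebra complex.
From mathcomp Require Import boolp classical_sets functions reals topology.
From mathcomp Require Import normedtype.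
From mathcomp Require Import ring.

Set Implicit Arguments.
Unset Strict Implicit.
Unset Printing Implicit Defensive.

Import Order.TTheory GRing.Theory Num.Theory.
Import numFieldNormedType.Exports.

Local Open Scope classical_set_scope.
Local Open Scope ring_scope.
Local Open Scope complex_scope.

(** Let [I] be the set of unit vectors [w] of C^2 with both coordinates nonzero,
    [A] the C*-algebra of bounded functions [I -> C] and [H] the Hilbert
    [A]-module of bounded functions [I -> C^2], with pointwise operations.  Let
    [P] project, at every point, onto the line of [(1, 0)], and let [Q] project
    onto the line of [w] at the point [w].  Since [1 - P] and [1 - Q] are the
    projections onto the orthogonal lines, each of the four cases concerns
    fields of lines [u], [v] with [det u v] nowhere zero and
    [inf |det u v| = 0].  The lines being distinct at every point, the ranges
    meet in 0 and the sum [P_u + P_v] is injective; the infimum being 0, the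
    field [perp u] is not a uniform limit of elements of the range of
    [P_u + P_v].  The orthogonal of that range is trivial, so its closure, being
    proper, is not complemented. *)

(** * Completeness of the complex numbers *)

(** Meant for the coordinates of C^2 and the evaluations of bounded maps: Cauchy filters are pushed
    to a space already known to be complete. *)
Lemma cauchy_fmap_nonexpansive (K : numFieldType) (W V : normedModType K)
    (f : W -> V) (F : set_system W) :
  (forall x y, `|f x - f y| <= `|x - y|) ->
  ProperFilter F -> cauchy F -> cauchy (f @ F).
Proof.
move=> f_le FF /cauchy_ballP Fc; apply/cauchyP => e e0.
have /cauchyP/(_ _ e0)[x Fx] : cauchy F by exact/cauchy_ballP.
exists (f x); change (F (f @^-1` ball (f x) e)); apply: filterS Fx => y /=.
by rewrite -!ball_normE /=; exact: le_lt_trans.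
Qed.

(** Real and imaginary parts do not increase distances, so both converge in [R], and the limits
    recombine. The norms of [R] and [R[i]] take values in different fields, hence the separate
    transfer [Cpart]. *)
Lemma complex_complete (R : realType) (F : set_system R[i]^o) :
  ProperFilter F -> cauchy F -> cvg F.
Proof.
move=> FF Fc.
have norm_i : `|'i%C : R[i]| = 1.
  by rewrite normc_def /= expr0n expr1n add0r sqrtr1.
have Cpart (f : R[i] -> R) : (forall x y, `|f x - f y|%:C <= `|x - y|) ->
    cvg (f @ F).
  move=> f_le; apply: R_complete; apply/cauchyP => e e0.
  have /cauchyP/(_ e%:C)[|x Fx] := Fc; first by rewrite ltcR.
  exists (f x); change (F (f @^-1` ball (f x) e)); apply: filterS Fx => y /=.
  by rewrite -!ball_normE /= => xy; rewrite -ltcR (le_lt_trans (f_le _ _)).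
have /Cpart/cvg_ex[a Fa] : forall x y : R[i],
    `|complex.Re x - complex.Re y|%:C <= `|x - y|.
  move=> x y; apply: le_trans (normc_ge_Re _).
  by case: x y => ? ? [].
have /Cpart/cvg_ex[b Fb] : forall x y : R[i],
    `|complex.Im x - complex.Im y|%:C <= `|x - y|.
  (* Multiplication by ['i] is isometric and turns the imaginary part into a real part, up to
     sign. *)
  move=> x y; have := normc_ge_Re ((x - y) * 'i%C).
  by rewrite normrM norm_i mulr1 ReiNIm normrN; case: x y => ? ? [].
apply/cvg_ex; exists (a +i* b); apply/cvgrPdist_le => e e0.
have [d -> d0] : exists2 d : R, e = d%:C & 0 < d.
  move: e0; rewrite ltcE => /andP[/eqP e1 e2]; exists (complex.Re e) => //.
  by case: e e1 {e2} => ? ? /= ->.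
near=> x.
have xE : a +i* b - x = (a - complex.Re x)%:C + 'i%C * (b - complex.Im x)%:C.
  case: (x) => u v; apply/eqP; rewrite eq_complex /=.
  by rewrite !(mul0r, mulr0, add0r, addr0, mul1r, subr0) !eqxx.
rewrite xE (le_trans (ler_normD _ _)) // normrM.
rewrite norm_i mul1r !normc_def /= expr0n /= !addr0 !sqrtr_sqr.
rewrite -rmorphD /= lecR (splitr d) lerD //; near: x;
  apply: cvgr_dist_le => //; exact: divr_gt0.
Unshelve. all: by end_near. Qed.

(* The library puts the normed structure on [R[i]^o] and on the abstract
   [numFieldType]s only, so that [complex] is not yet a key for unification. *)
HB.instance Definition _ (R : realType) := NormedModule.copy R[i] R[i]^o.

HB.instance Definition _ (R : realType) :=
  Uniform_isComplete.Build R[i] (@complex_complete R).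

(* An alias is needed for the Euclidean norm: the product carries the sup norm. *)
Definition plane (R : realType) : Type := (R[i] * R[i])%type.

HB.instance Definition _ (R : realType) :=
  GRing.Lmodule.copy (plane R) (R[i] * R[i])%type.

(** * The Hilbert space C^2 *)

Section Plane.
Context {R : realType}.
Implicit Types (x y z : plane R) (a : R[i]).

Definition plane_norm x : R[i] := sqrtC (`|x.1| ^+ 2 + `|x.2| ^+ 2).

Let sqs_ge0 x : 0 <= `|x.1| ^+ 2 + `|x.2| ^+ 2 :> R[i].
Proof. by rewrite addr_ge0 ?exprn_ge0. Qed.

(** Lagrange's identity for the moduli: after squaring, the difference of the two sides is the
    square of a real number. *)
Lemma plane_norm_CauchySchwarz x y :
  `|x.1| * `|y.1| + `|x.2| * `|y.2| <= plane_norm x * plane_norm y.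
Proof.
rewrite -ler_sqr ?nnegrE ?mulr_ge0 ?addr_ge0 ?mulr_ge0 ?sqrtC_ge0 //.
rewrite exprMn !sqrtCK -subr_ge0.
set a := `|x.1|; set b := `|x.2|; set c := `|y.1|; set d := `|y.2|.
have -> : (a ^+ 2 + b ^+ 2) * (c ^+ 2 + d ^+ 2) - (a * c + b * d) ^+ 2 =
  (a * d - b * c) ^+ 2 by ring.
by rewrite real_exprn_even_ge0 // rpredB ?rpredM ?normr_real.
Qed.

(** The triangle inequality in each coordinate reduces this to moduli, where the difference of the
    squares is twice the defect in Cauchy-Schwarz. *)
Lemma plane_normD x y : plane_norm (x + y) <= plane_norm x + plane_norm y.
Proof.
rewrite -ler_sqr ?nnegrE ?addr_ge0 ?sqrtC_ge0 // sqrrD !sqrtCK.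
apply: (@le_trans _ _ ((`|x.1| + `|y.1|) ^+ 2 + (`|x.2| + `|y.2|) ^+ 2)).
  by rewrite lerD // ler_sqr ?nnegrE ?addr_ge0 // ler_normD.
rewrite -subr_ge0.
have -> : `|x.1| ^+ 2 + `|x.2| ^+ 2 + plane_norm x * plane_norm y *+ 2 +
    (`|y.1| ^+ 2 + `|y.2| ^+ 2) -
    ((`|x.1| + `|y.1|) ^+ 2 + (`|x.2| + `|y.2|) ^+ 2) =
    (plane_norm x * plane_norm y - (`|x.1| * `|y.1| + `|x.2| * `|y.2|)) *+ 2.
  by ring.
by rewrite mulrn_wge0 // subr_ge0 plane_norm_CauchySchwarz.
Qed.

Lemma plane_normZ a x : plane_norm (a *: x) = `|a| * plane_norm x.
Proof.
rewrite /plane_norm /= !normrM !exprMn -mulrDr.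
by rewrite sqrtCM ?nnegrE ?exprn_ge0 // sqrCK.
Qed.

Lemma plane_norm_eq0 x : plane_norm x = 0 -> x = 0.
Proof.
move=> /eqP; rewrite sqrtC_eq0 paddr_eq0 ?exprn_ge0 //.
rewrite !expf_eq0 /= !normr_eq0; case: x => ? ? /= /andP[/eqP-> /eqP->].
by [].
Qed.

HB.instance Definition _ := Lmodule_isNormed.Build R[i] (plane R)
  plane_normD plane_normZ plane_norm_eq0.

Lemma sqr_norm_plane x : `|x| ^+ 2 = `|x.1| ^+ 2 + `|x.2| ^+ 2.
Proof. exact: sqrtCK. Qed.

Lemma norm_plane1 x : `|x.1| <= `|x|.
Proof.
by rewrite -ler_sqr ?nnegrE // sqr_norm_plane lerDl exprn_ge0.
Qed.

Lemma norm_plane2 x : `|x.2| <= `|x|.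
Proof.
by rewrite -ler_sqr ?nnegrE // sqr_norm_plane lerDr exprn_ge0.
Qed.

Lemma norm_plane_le x : `|x| <= `|x.1| + `|x.2|.
Proof.
rewrite -ler_sqr ?nnegrE ?addr_ge0 // sqr_norm_plane sqrrD.
by rewrite addrAC lerDl mulrn_wge0 // mulr_ge0.
Qed.

Lemma plane_complete (F : set_system (plane R)) :
  ProperFilter F -> cauchy F -> cvg F.
Proof.
move=> FF Fc.
have /cauchy_cvg/cvg_ex[a Fa] : cauchy (fst @ F : set_system R[i]).
  apply: (@cauchy_fmap_nonexpansive _ (plane R) R[i] fst) => // x y.
  exact: (norm_plane1 (x - y)).
have /cauchy_cvg/cvg_ex[b Fb] : cauchy (snd @ F : set_system R[i]).
  apply: (@cauchy_fmap_nonexpansive _ (plane R) R[i] snd) => // x y.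
  exact: (norm_plane2 (x - y)).
apply/cvg_ex; exists (a, b).
apply/(@cvgrPdist_le _ (plane R) _ F _ id) => e e0.
have e2 : 0 < e / 2 by exact: divr_gt0.
move/cvgrPdist_le : Fa => /(_ _ e2) Fa; move/cvgrPdist_le : Fb => /(_ _ e2) Fb.
near=> x.
apply: le_trans (norm_plane_le _) _ => /=; rewrite (splitr e).
by apply: lerD; near: x.
Unshelve. all: by end_near. Qed.

HB.instance Definition _ := Uniform_isComplete.Build (plane R) plane_complete.

Definition dot x y : R[i] := Num.conj x.1 * y.1 + Num.conj x.2 * y.2.

Lemma dotDr x y z : dot x (y + z) = dot x y + dot x z.
Proof. by rewrite /dot /=; ring. Qed.

Lemma dotNr x y : dot x (- y) = - dot x y.
Proof. by rewrite /dot /=; ring. Qed.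

Lemma dotZr a x y : dot x (a *: y) = a * dot x y.
Proof. by rewrite /dot /= -![_ *: _]/(_ * _); ring. Qed.

Lemma conj_dot x y : Num.conj (dot x y) = dot y x.
Proof. by rewrite /dot rmorphD !rmorphM /= !conjCK; ring. Qed.

Lemma dot_norm x : dot x x = `|x| ^+ 2.
Proof. by rewrite sqr_norm_plane !normCK /dot; ring. Qed.

Lemma norm_dot_le x y : `|dot x y| <= `|x| * `|y|.
Proof.
apply: le_trans (ler_normD _ _) _; rewrite !normrM !norm_conjC.
exact: plane_norm_CauchySchwarz.
Qed.

End Plane.

(** * Bounded maps into a Banach space, with the supremum norm *)

Lemma RRe_ge0 (R : realType) (x : R[i]) : 0 <= x -> (complex.Re x)%:C = x.
Proof. by move=> x0; rewrite RRe_real ?ger0_real. Qed.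

Lemma Re_ge0 (R : realType) (x : R[i]) : 0 <= x -> 0 <= complex.Re x.
Proof. by move=> x0; rewrite -ler0c RRe_ge0. Qed.

Section BoundedMaps.
Context {R : realType} (I : Type) (V : completeNormedModType R[i]).

(** The bounds are real, so that an infimum exists although norms lie in [R[i]]. Asking [0 <= M]
    keeps the set bounded below even for empty [I]. *)
Definition bounds (f : I -> V) : set R :=
  [set M | 0 <= M /\ forall i, `|f i| <= M%:C].

Definition bounded_map_pred : {pred I -> V} :=
  [pred f | `[< bounds f !=set0 >]].

Fact bounded_map_submod_closed : GRing.submod_closed bounded_map_pred.
Proof.
split=> [|a f g /asboolP[M [M0 fM]] /asboolP[N [N0 gN]]]; apply/asboolP.
  by exists 0; split=> // i; rewrite normr0.
exists (complex.Re `|a| * M + N); split=> [|i].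
  by rewrite addr_ge0 // mulr_ge0 // Re_ge0.
apply: le_trans (ler_normD (a *: f i) (g i)) _.
rewrite rmorphD lerD // normrZ rmorphM /=.
exact: ler_wpM2l.
Qed.

HB.instance Definition _ :=
  GRing.isSubmodClosed.Build _ _ bounded_map_pred bounded_map_submod_closed.

Record bounded_map : Type := BoundedMap {
  bounded_map_fun :> I -> V ;
  bounded_map_funP : bounded_map_fun \in bounded_map_pred }.

HB.instance Definition _ := [isSub for bounded_map_fun].
HB.instance Definition _ := [Choice of bounded_map by <:].
HB.instance Definition _ := [SubChoice_isSubLmodule of bounded_map by <:].

Implicit Types (f g : bounded_map).

Lemma bounded_mapP f g : (forall i, f i = g i) -> f = g.
Proof. by move=> fg; apply: val_inj; apply/funext. Qed.

Definition sup_norm f : R := inf (bounds f).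

Let bounds_neq0 f : bounds f !=set0.
Proof. by apply/asboolP; exact: bounded_map_funP. Qed.

Let bounds_lb0 f : lbound (bounds f) 0.
Proof. by move=> M []. Qed.

Lemma sup_norm_ge0 f : 0 <= sup_norm f.
Proof. exact: lb_le_inf. Qed.

Lemma sup_norm_ler f (M : R) :
  0 <= M -> (forall i, `|f i| <= M%:C) -> sup_norm f <= M.
Proof. by move=> M0 fM; apply: ge_inf; [exists 0 | split]. Qed.

Lemma norm_le_sup_norm f i : `|f i| <= (sup_norm f)%:C.
Proof.
rewrite -[X in X <= _]RRe_ge0 // lecR.
apply: lb_le_inf => // M [M0 /(_ i)].
by rewrite -[X in X <= _]RRe_ge0 // lecR.
Qed.

Lemma sup_normD f g :
  (sup_norm (f + g))%:C <= (sup_norm f)%:C + (sup_norm g)%:C.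
Proof.
rewrite -rmorphD lecR sup_norm_ler ?addr_ge0 ?sup_norm_ge0 // => i.
apply: le_trans (ler_normD (f i) (g i)) _.
by rewrite rmorphD lerD // norm_le_sup_norm.
Qed.

Let sup_normZ_le (a : R[i]) f :
  sup_norm (a *: f) <= complex.Re `|a| * sup_norm f.
Proof.
apply: sup_norm_ler; first by rewrite mulr_ge0 ?Re_ge0 ?sup_norm_ge0.
move=> i; rewrite [bounded_map_fun _ i]/(a *: f i) normrZ rmorphM /=.
apply: ler_wpM2l => //; exact: norm_le_sup_norm.
Qed.

Lemma sup_normZ (a : R[i]) f : (sup_norm (a *: f))%:C = `|a| * (sup_norm f)%:C.
Proof.
have [->|a0] := eqVneq a 0.
  rewrite scale0r normr0 mul0r; congr (_%:C); apply/eqP.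
  rewrite eq_le sup_norm_ge0 andbT sup_norm_ler // => i.
  by rewrite [bounded_map_fun _ i]/(0 : V) normr0.
have Ea0 : 0 < complex.Re `|a| by rewrite -ltcR RRe_ge0 // normr_gt0.
rewrite -[`|a|]RRe_ge0 // -rmorphM /=; congr (_%:C).
apply/le_anti/andP; split => //.
(* The reverse inequality is the direct one applied to [a^-1] and [a *: f]. *)
rewrite -ler_pdivlMl //.
apply: (@le_trans _ _ (complex.Re `|a^-1| * sup_norm (a *: f))).
  by rewrite -{1}[f](scalerK a0).
rewrite ler_wpM2r ?sup_norm_ge0 //.
suff -> : complex.Re `|a^-1| = (complex.Re `|a|)^-1 by [].
apply: complexI; rewrite RRe_ge0 // normfV -[in LHS](RRe_ge0 (normr_ge0 a)).
by rewrite [RHS]fmorphV.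
Qed.

Lemma sup_norm_eq0 f : (sup_norm f)%:C = 0 -> f = 0.
Proof.
move=> f0; apply: bounded_mapP => i; apply/eqP.
by rewrite -normr_le0 (le_trans (norm_le_sup_norm f i)) // f0.
Qed.

HB.instance Definition _ := Lmodule_isNormed.Build R[i] bounded_map
  sup_normD sup_normZ sup_norm_eq0.

Lemma norm_bounded_mapE f : `|f| = (sup_norm f)%:C.
Proof. by []. Qed.

Lemma norm_bounded_map_ge f i : `|f i| <= `|f|.
Proof. exact: norm_le_sup_norm. Qed.

Lemma norm_bounded_map_le f (M : R[i]) :
  0 <= M -> (forall i, `|f i| <= M) -> `|f| <= M.
Proof.
move=> M0; rewrite -(RRe_ge0 M0) => fM.
by rewrite norm_bounded_mapE lecR sup_norm_ler // Re_ge0.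
Qed.

Lemma bounded_mapI (f : I -> V) (M : R[i]) :
  0 <= M -> (forall i, `|f i| <= M) -> f \in bounded_map_pred.
Proof.
move=> M0 fM; apply/asboolP; exists (complex.Re M).
by split=> [|i]; rewrite ?RRe_ge0 ?Re_ge0.
Qed.

(** The pointwise limit [l] is shown to be a uniform limit, and then bounded. *)
Lemma bounded_map_complete (F : set_system bounded_map) :
  ProperFilter F -> cauchy F -> cvg F.
Proof.
move=> FF Fc.
have /choice[l Fl] : forall i, exists y : V, (fun f => f i) @ F --> y.
  move=> i; apply/cvg_ex; apply: (@cauchy_cvg V).
  apply: (@cauchy_fmap_nonexpansive _ bounded_map V (fun f => f i)) => // f g.
  exact: (norm_bounded_map_ge (f - g)).
have unif (e : R[i]) : 0 < e ->
    \forall f \near F, forall i, `|l i - (f : bounded_map) i| <= e.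
  move=> e0; have e2 : 0 < e / 2 by exact: divr_gt0.
  have e4 : 0 < e / 2 / 2 by exact: divr_gt0.
  have /cauchyP/(_ _ e4)[f0 Ff0] := Fc; move: (Ff0); rewrite -ball_normE /=.
  apply: filterS => f f0f i.
  move/cvgrPdist_le : (Fl i) => /(_ _ e2) Fli.
  (* Only the auxiliary [g] depends on [i]: it is within [e / 2] of [l] at [i], and [f] and [g] are
     both within [e / 4] of [f0] in norm. *)
  near F => g; rewrite -(subrKA (g i)) (splitr e).
  apply: le_trans (ler_normD _ _) _; apply: lerD; first by near: g.
  apply: le_trans (norm_bounded_map_ge (g - f) i) _.
  rewrite -(subrKA f0) (splitr (e / 2)); apply: le_trans (ler_normD _ _) _.
  apply: lerD; last exact: ltW.
  rewrite distrC; near: g; move: Ff0; rewrite -ball_normE /=.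
  by apply: filterS => g /ltW.
have [f Ff] : exists f : bounded_map, forall i, `|l i - f i| <= 1.
  by near F => f; exists f; near: f; exact: unif.
have lb : l \in bounded_map_pred.
  apply: (@bounded_mapI _ (`|f| + 1)) => [|i]; first by rewrite addr_ge0.
  rewrite -[l i](subrK (f i)) addrC; apply: le_trans (ler_normD _ _) _.
  by rewrite lerD // norm_bounded_map_ge.
apply/cvg_ex; exists (BoundedMap lb).
apply/(@cvgrPdist_le _ bounded_map _ F _ id) => e e0.
move: (unif _ e0); apply: filterS => g lg.
exact: (@norm_bounded_map_le (BoundedMap lb - g) e (ltW e0) lg).
Unshelve. all: by end_near. Qed.

HB.instance Definition _ :=
  Uniform_isComplete.Build bounded_map bounded_map_complete.

End BoundedMaps.

(** Squaring is monotone on nonnegative numbers, so it commutes with suprema. Both the C*-identity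
    and the formula for the norm of the Hilbert module are instances. *)
Lemma norm_bounded_map_sqr (R : realType) (I : Type)
    (V W : completeNormedModType R[i]) (f : bounded_map I V)
    (g : bounded_map I W) :
  (forall i, `|g i| = `|f i| ^+ 2) -> `|f| ^+ 2 = `|g|.
Proof.
move=> gf; apply/le_anti/andP; split.
  rewrite -[leRHS]sqrtCK ler_sqr ?nnegrE ?sqrtC_ge0 //.
  apply: norm_bounded_map_le => [|i]; first by rewrite sqrtC_ge0.
  rewrite -ler_sqr ?nnegrE ?sqrtC_ge0 // sqrtCK -gf.
  exact: norm_bounded_map_ge.
apply: norm_bounded_map_le => [|i]; first by rewrite exprn_ge0.
by rewrite gf ler_sqr ?nnegrE // norm_bounded_map_ge.
Qed.

(** * The C*-algebra of bounded functions and its Hilbert module *)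

Section BoundedFunctions.
Context {R : realType} (I : Type).
Local Notation A := (bounded_map I R[i]).
Local Notation H := (bounded_map I (plane R)).
Implicit Types (a b c : A) (x y z : H) (k : R[i]).

Fact bmul_subproof a b : (fun i => a i * b i) \in @bounded_map_pred R I R[i].
Proof.
apply: (@bounded_mapI _ _ _ _ (`|a| * `|b|)) => [|i]; first by rewrite mulr_ge0.
by rewrite normrM ler_pM // norm_bounded_map_ge.
Qed.
Definition bmul a b : A := BoundedMap (bmul_subproof a b).

Fact bconj_subproof a :
  (fun i => Num.conj (a i)) \in @bounded_map_pred R I R[i].
Proof.
apply: (@bounded_mapI _ _ _ _ `|a|) => // i.
by rewrite norm_conjC norm_bounded_map_ge.
Qed.
Definition bconj a : A := BoundedMap (bconj_subproof a).

Fact bmulA a b c : bmul a (bmul b c) = bmul (bmul a b) c.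
Proof. by apply: bounded_mapP => i; exact: mulrA. Qed.
Fact bmulDl a b c : bmul (a + b) c = bmul a c + bmul b c.
Proof. by apply: bounded_mapP => i; exact: mulrDl. Qed.
Fact bmulDr a b c : bmul a (b + c) = bmul a b + bmul a c.
Proof. by apply: bounded_mapP => i; exact: mulrDr. Qed.
Fact bmulZl k a b : bmul (k *: a) b = k *: bmul a b.
Proof. by apply: bounded_mapP => i; exact/esym/mulrA. Qed.
Fact bmulZr k a b : bmul a (k *: b) = k *: bmul a b.
Proof. by apply: bounded_mapP => i; exact: (mulrCA (a i) k (b i)). Qed.
Fact norm_bmul a b : `|bmul a b| <= `|a| * `|b|.
Proof.
apply: norm_bounded_map_le => [|i]; first by rewrite mulr_ge0.
by rewrite normrM ler_pM // norm_bounded_map_ge.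
Qed.
Fact bconjK a : bconj (bconj a) = a.
Proof. by apply: bounded_mapP => i; exact: conjCK. Qed.
Fact bconjD a b : bconj (a + b) = bconj a + bconj b.
Proof. by apply: bounded_mapP => i; exact: rmorphD. Qed.
Fact bconjZ k a : bconj (k *: a) = Num.conj k *: bconj a.
Proof. by apply: bounded_mapP => i; exact: (rmorphM Num.conj k (a i)). Qed.
Fact bconjM a b : bconj (bmul a b) = bmul (bconj b) (bconj a).
Proof. by apply: bounded_mapP => i /=; rewrite rmorphM mulrC. Qed.
Fact norm_bconj_mul a : `|bmul (bconj a) a| = `|a| ^+ 2.
Proof.
apply/esym/norm_bounded_map_sqr => i.
by rewrite normrM norm_conjC.
Qed.

HB.instance Definition _ := isCStarAlgebra.Build R A
  bmulA bmulDl bmulDr bmulZl bmulZr norm_bmul bconjK bconjD bconjZ bconjM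
  norm_bconj_mul.

Fact bact_subproof x a :
  (fun i => a i *: x i) \in @bounded_map_pred R I (plane R).
Proof.
apply: (@bounded_mapI _ _ _ _ (`|a| * `|x|)) => [|i]; first by rewrite mulr_ge0.
by rewrite normrZ ler_pM // norm_bounded_map_ge.
Qed.
Definition bact x a : H := BoundedMap (bact_subproof x a).

Fact bdot_subproof x y :
  (fun i => dot (x i) (y i)) \in @bounded_map_pred R I R[i].
Proof.
apply: (@bounded_mapI _ _ _ _ (`|x| * `|y|)) => [|i]; first by rewrite mulr_ge0.
apply: le_trans (norm_dot_le _ _) _.
by rewrite ler_pM // norm_bounded_map_ge.
Qed.
Definition bdot x y : A := BoundedMap (bdot_subproof x y).

Fact bactDl x y a : bact (x + y) a = bact x a + bact y a.
Proof. by apply: bounded_mapP => i; exact: scalerDr. Qed.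
Fact bactDr x a b : bact x (a + b) = bact x a + bact x b.
Proof. by apply: bounded_mapP => i; exact: scalerDl. Qed.
Fact bactA x a b : bact x (cmul a b) = bact (bact x a) b.
Proof.
by apply: bounded_mapP => i; rewrite /= scalerA mulrC.
Qed.
Fact bactZl k x a : bact (k *: x) a = k *: bact x a.
Proof.
apply: bounded_mapP => i; rewrite [LHS](scalerA (a i) k (x i)) mulrC.
exact/esym/scalerA.
Qed.
Fact bactZr k x a : bact x (k *: a) = k *: bact x a.
Proof. by apply: bounded_mapP => i; exact/esym/scalerA. Qed.
Fact bdotDr x y z : bdot x (y + z) = bdot x y + bdot x z.
Proof. by apply: bounded_mapP => i; exact: dotDr. Qed.
Fact bdotZr k x y : bdot x (k *: y) = k *: bdot x y.
Proof. by apply: bounded_mapP => i; exact: dotZr. Qed.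
Fact bdot_act x y a : bdot x (bact y a) = cmul (bdot x y) a.
Proof. by apply: bounded_mapP => i /=; rewrite dotZr mulrC. Qed.
Fact bdot_conj x y : bdot y x = star (bdot x y).
Proof. by apply: bounded_mapP => i; exact/esym/conj_dot. Qed.
Fact bdot_pos x : cstar_pos (bdot x x).
Proof.
(* The pointwise norm of [x] is a self-adjoint square root of [bdot x x]. *)
have nb : (fun i => `|x i|) \in @bounded_map_pred R I R[i].
  apply: (@bounded_mapI _ _ _ _ `|x|) => // i.
  by rewrite normr_id norm_bounded_map_ge.
exists (BoundedMap nb); apply: bounded_mapP => i /=.
by rewrite dot_norm (CrealP (normr_real _)).
Qed.
Fact bdot_eq0 x : bdot x x = 0 -> x = 0.
Proof.
move=> xx0; apply: bounded_mapP => i; apply/eqP.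
have : bdot x x i = 0 by rewrite xx0.
by rewrite /= dot_norm => /eqP; rewrite expf_eq0 /= normr_eq0.
Qed.
Fact norm_bdot x : `|x| ^+ 2 = `|bdot x x|.
Proof.
by apply: norm_bounded_map_sqr => i /=; rewrite dot_norm normrX normr_id.
Qed.

HB.instance Definition _ := @isHilbertModule.Build R A H bact bdot
  bactDl bactDr bactA bactZl bactZr bdotDr bdotZr bdot_act bdot_conj bdot_pos
  bdot_eq0 norm_bdot.

End BoundedFunctions.

(** * Unit vectors of C^2 and their orthogonal complements *)

Record sphere (R : realType) := Sphere {
  sphere_vec :> plane R ; dot_sphere : dot sphere_vec sphere_vec = 1 }.

Section Sphere.
Context {R : realType}.
Implicit Types (v w : sphere R) (x : plane R).

Lemma norm_sphere v : `|v : plane R| = 1.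
Proof. by apply/eqP; rewrite -sqrp_eq1 // -dot_norm dot_sphere. Qed.

Fact perp_subproof v :
  let w : plane R := (- Num.conj (v : plane R).2, Num.conj (v : plane R).1) in
  dot w w = 1.
Proof. by rewrite /= -[RHS](dot_sphere v) /dot /= rmorphN /= !conjCK; ring. Qed.
Definition perp v : sphere R := Sphere (perp_subproof v).

Lemma dot_perpr v : dot v (perp v) = 0.
Proof. by rewrite /dot /=; ring. Qed.

Lemma dot_perpl v : dot (perp v) v = 0.
Proof. by rewrite -conj_dot dot_perpr conjC0. Qed.

(** Expansion of [x] in the orthonormal basis [v], [perp v]. *)
Lemma sphere_decomp v x :
  x = dot v x *: (v : plane R) + dot (perp v) x *: (perp v : plane R).
Proof.
have v1 := dot_sphere v; case: x v1 => a b; case: v => -[c d] /= _.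
rewrite /dot /= rmorphN /= !conjCK => v1.
(* Multiplying the left side by [1 = dot v v] makes each coordinate a polynomial identity. *)
by congr (_, _) => /=; rewrite -[LHS]mul1r -v1
  -[X in _ = X + _]/(_ * _) -[X in _ = _ + X]/(_ * _); ring.
Qed.

End Sphere.

(** * Projections onto fields of lines *)

Section Projections.
Context {R : realType} {I : Type}.
Local Notation A := (bounded_map I R[i]).
Local Notation H := (bounded_map I (plane R)).
Implicit Types (u v : I -> sphere R) (x y z : H).

Lemma innerE x y i : (inner x y : A) i = dot (x i) (y i).
Proof. by []. Qed.

Fact sphere_map_subproof u :
  (fun i => sphere_vec (u i)) \in @bounded_map_pred R I (plane R).
Proof. by apply: (@bounded_mapI _ _ _ _ 1) => // i; rewrite norm_sphere. Qed.
Definition sphere_map u : H := BoundedMap (sphere_map_subproof u).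

Definition line_proj u x : H := ract (sphere_map u) (inner (sphere_map u) x : A).

Lemma line_projE u x i : line_proj u x i = dot (u i) (x i) *: (u i : plane R).
Proof. by []. Qed.

Lemma line_proj_adjoint u : @is_adjoint _ A H (line_proj u) (line_proj u).
Proof.
move=> x y; apply: bounded_mapP => i; rewrite !innerE !line_projE.
by rewrite dotZr -conj_dot dotZr rmorphM /= !conj_dot mulrC.
Qed.

Lemma line_proj_idem u : line_proj u \o line_proj u = line_proj u.
Proof.
apply/funext => x; apply: bounded_mapP => i.
by rewrite /comp !line_projE dotZr dot_sphere mulr1.
Qed.

Lemma projection_line_proj u : @projection _ A H (line_proj u).
Proof.
split; [|exact: line_proj_idem|exact: line_proj_adjoint].
by exists (line_proj u); exact: line_proj_adjoint.
Qed.

Lemma subr_line_proj u : idfun \- line_proj u = line_proj (perp \o u).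
Proof.
apply/funext => x; apply: bounded_mapP => i.
change (x i - line_proj u x i = line_proj (perp \o u) x i).
by rewrite [X in X - _](sphere_decomp (u i)) !line_projE addrC addKr.
Qed.

Lemma line_proj_perp u x : line_proj u (line_proj (perp \o u) x) = 0.
Proof.
apply: bounded_mapP => i; rewrite !line_projE dotZr dot_perpr mulr0.
exact: scale0r.
Qed.

(** A vector killed by a projection is fixed by the complementary one. *)
Lemma null_space_line_proj u :
  @null_space _ A H (line_proj u) = range (line_proj (perp \o u)).
Proof.
apply/seteqP; split=> [x ux0|_ [x _ <-]]; last exact: line_proj_perp.
exists x => //; rewrite -subr_line_proj.
by change (x - line_proj u x = x); rewrite ux0 subr0.
Qed.

(** The conjugations in [perp] cancel those in [dot], leaving the determinant [u1 v2 - u2 v1]; it is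
    also the coordinate of [v] along [perp u]. *)
Definition det u v i : R[i] := dot (perp (u i)) (v i).

Section Pair.
Variables u v : I -> sphere R.
Hypothesis det_neq0 : forall i, det u v i != 0.

(** A common element is a multiple of [v] with no component along [perp u], so its coefficient times
    [det u v] vanishes. *)
Lemma range_line_proj_disjoint :
  range (line_proj u) `&` range (line_proj v) = [set 0].
Proof.
apply/seteqP; split=> [z [[x _ xz] [y _ yz]]|_ ->]; last first.
  have l0 w : line_proj w 0 = 0.
    apply: bounded_mapP => i.
    change (dot (w i) 0 *: (w i : plane R) = 0).
    by rewrite /dot /= !mulr0 addr0 scale0r.
  by split; exists 0.
apply: bounded_mapP => i.
have : dot (perp (u i)) (z i) = 0.
  by rewrite -xz line_projE dotZr dot_perpl mulr0.
rewrite -yz line_projE dotZr => /eqP; rewrite mulf_eq0 (negPf (det_neq0 i)).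
by rewrite orbF => /eqP ->; exact: scale0r.
Qed.

Hypothesis det_small : forall e : R[i], 0 < e -> exists i, `|det u v i| <= e.

(* [sphere_map (perp \o u)] stays at distance at least 1/2 of the range: its
   coordinate along [perp u] is 1, that of [P_u g + P_v g] is [<v, g> det u v]. *)
Lemma closure_range_neqT :
  closure (range (line_proj u \+ line_proj v)) <> [set: H].
Proof.
move=> clT.
have : closure (range (line_proj u \+ line_proj v)) (sphere_map (perp \o u)).
  by rewrite clT.
have half0 : 0 < 2^-1 :> R[i] by rewrite invr_gt0.
move=> /(_ _ (nbhsx_ballx _ _ half0)) [_ [[g _ <-]]].
rewrite -ball_normE /= => near_g.
have g1 : 0 < `|g| + 1 by rewrite ltr_wpDl.
(* The point depends on the approximant [g]: there [det u v] is small enough to bring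
   [<v, g> det u v] down to 1/2. Adding 1 keeps the denominator positive when [g = 0]. *)
have [i di] : exists i, `|det u v i| <= 2^-1 / (`|g| + 1).
  by apply: det_small; rewrite divr_gt0.
set w : plane R := perp (u i); pose h := line_proj u g + line_proj v g.
have dot_h : dot w (h i) = dot (v i) (g i) * det u v i.
  change (h i) with (line_proj u g i + line_proj v g i).
  by rewrite dotDr !line_projE !dotZr dot_perpl mulr0 add0r.
have lt1 : `|1 - dot w (h i)| < 2^-1.
  have -> : 1 - dot w (h i) = dot w ((sphere_map (perp \o u) - h) i).
    change ((sphere_map (perp \o u) - h) i) with (w - h i).
    by rewrite dotDr dotNr dot_sphere.
  apply: le_lt_trans (norm_dot_le _ _) _; rewrite norm_sphere mul1r.
  exact: le_lt_trans (norm_bounded_map_ge _ i) near_g.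
have lt2 : `|dot w (h i)| <= 2^-1.
  rewrite dot_h normrM.
  have gi : `|dot (v i) (g i)| <= `|g| + 1.
    apply: le_trans (norm_dot_le _ _) _; rewrite norm_sphere mul1r.
    by rewrite (le_trans (norm_bounded_map_ge g i)) // lerDl.
  apply: le_trans (ler_pM _ _ gi di) _ => //.
  by rewrite mulrCA divff ?mulr1 // gt_eqF.
have : `|1 : R[i]| < 1.
  rewrite -[X in `|X|](subrK (dot w (h i))) [X in _ < X](splitr 1) !mul1r.
  by apply: le_lt_trans (ler_normD _ _) _; exact: ltr_leD.
by rewrite normr1 ltxx.
Qed.

(* If [z] is orthogonal to the range of [P_u + P_v] then pointwise
   [0 = <z, (P_u + P_v) z> = |P_u z|^2 + |P_v z|^2], whence [z = 0]. *)
Lemma not_orthogonally_complemented :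
  ~ @orthogonally_complemented _ A H
      (closure (range (line_proj u \+ line_proj v))).
Proof.
move=> oc; apply: closure_range_neqT; apply/seteqP; split=> // x _.
have [y [z [yM zM ->]]] := oc x; suff -> : z = 0 by rewrite addr0.
have zT : inner z (line_proj u z + line_proj v z) = 0 :> A.
  by apply: zM; apply: subset_closure; exists z.
apply: bounded_mapP => i.
have : dot (z i) (line_proj u z i + line_proj v z i) = 0.
  by change ((inner z (line_proj u z + line_proj v z) : A) i = 0); rewrite zT.
rewrite !line_projE dotDr !dotZr -[dot (z i) (u i)]conj_dot.
rewrite -[dot (z i) (v i)]conj_dot -!normCK => /eqP.
rewrite paddr_eq0 ?exprn_ge0 // !expf_eq0 /= !normr_eq0 => /andP[/eqP uz /eqP].
(* Since [<u, z> = 0], only the component along [perp u] remains, and [<v, perp u>] is the conjugate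
   of the nonzero [det u v]. *)
rewrite (sphere_decomp (u i) (z i)) uz scale0r add0r dotZr => /eqP.
rewrite -[dot (v i) _]conj_dot mulf_eq0 conjC_eq0 (negPf (det_neq0 i)).
by rewrite orbF => /eqP ->; exact: scale0r.
Qed.

End Pair.
End Projections.

(** * Unit vectors close to the coordinate axes, and the counterexample *)

Lemma small_unit_vector (R : realType) (e : R[i]) : 0 < e ->
  exists s c : R[i], [/\ s != 0, c != 0, `|s| <= e &
    Num.conj s * s + Num.conj c * c = 1].
Proof.
move=> e0; have e1 : 0 < 1 + e by rewrite addr_gt0.
(* This [s] is at most [e] and stays below 1 however large [e] is, so [c] is nonzero. *)
pose s := e / (1 + e); pose c := sqrtC (1 - s ^+ 2).
have s0 : 0 < s by rewrite divr_gt0.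
have s1 : s < 1 by rewrite ltr_pdivrMr // mul1r ltrDr.
have c0 : 0 < 1 - s ^+ 2 by rewrite subr_gt0 exprn_ilt1 // ltW.
exists s, c; split.
- by rewrite gt_eqF.
- by rewrite sqrtC_eq0 gt_eqF.
- by rewrite gtr0_norm // ler_pdivrMr // ler_peMr ?ltW // ltrDl.
have cge : 0 <= c by rewrite sqrtC_ge0 ltW.
rewrite (CrealP (gtr0_real s0)) (CrealP (ger0_real cge)) -!expr2 sqrtCK.
by rewrite addrC subrK.
Qed.

Record generic_vector (R : realType) := GenericVector {
  generic_sphere :> sphere R ;
  generic1 : (generic_sphere : plane R).1 != 0 ;
  generic2 : (generic_sphere : plane R).2 != 0 }.

Lemma generic_fst_small (R : realType) (e : R[i]) : 0 < e ->
  exists w : generic_vector R, `|(w : plane R).1| <= e.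
Proof.
move=> /small_unit_vector[s [c [s0 c0 se sc1]]].
have v1 : dot ((s, c) : plane R) (s, c) = 1 by [].
by exists (@GenericVector R (Sphere v1) s0 c0).
Qed.

Lemma generic_snd_small (R : realType) (e : R[i]) : 0 < e ->
  exists w : generic_vector R, `|(w : plane R).2| <= e.
Proof.
move=> /small_unit_vector[s [c [s0 c0 se sc1]]].
have v1 : dot ((c, s) : plane R) (c, s) = 1 by rewrite /dot addrC.
by exists (@GenericVector R (Sphere v1) c0 s0).
Qed.

Fact dot_e1 (R : realType) : dot ((1, 0) : plane R) (1, 0) = 1.
Proof. by rewrite /dot /= mulr0 addr0 mulr1 conjC1. Qed.

Theorem mainTheorem4 (R : realType) :
  exists (A : cstarAlgType R) (H : hilbertModType A) (P Q : H -> H),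
    [/\ projection P,
        projection Q,
        [/\ range P `&` range Q = [set 0],
            range P `&` null_space Q = [set 0],
            null_space P `&` range Q = [set 0]
          & null_space P `&` null_space Q = [set 0]],
        [/\ closure (range (P \+ Q)) <> [set: H],
            closure (range (P \+ (idfun \- Q))) <> [set: H],
            closure (range ((idfun \- P) \+ Q)) <> [set: H]
          & closure (range ((idfun \- P) \+ (idfun \- Q))) <> [set: H]]
      & [/\ ~ orthogonally_complemented (closure (range (P \+ Q))),
            ~ orthogonally_complemented (closure (range (P \+ (idfun \- Q)))),
            ~ orthogonally_complemented (closure (range ((idfun \- P) \+ Q)))
          & ~ orthogonally_complemented
                (closure (range ((idfun \- P) \+ (idfun \- Q))))]].
Proof.
pose I := generic_vector R.
pose u (w : I) := Sphere (dot_e1 R).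
pose v (w : I) : sphere R := w.
exists (bounded_map I R[i]), (bounded_map I (plane R)).
exists (line_proj u), (line_proj v).
(* Up to sign and conjugation, the four determinants are coordinates of [w]: the second one when
   [perp] is applied to none or both of [u] and [v], the first one otherwise. *)
have d1 w : `|det u v w| = `|(w : plane R).2|.
  by rewrite /det /dot /= !(conjC0, conjC1, oppr0, mul0r, mul1r, add0r).
have d2 w : `|det u (perp \o v) w| = `|(w : plane R).1|.
  rewrite /det /dot /= !(conjC0, conjC1, oppr0, mul0r, mul1r, add0r).
  exact: norm_conjC.
have d3 w : `|det (perp \o u) v w| = `|(w : plane R).1|.
  rewrite /det /dot /= !(conjC0, conjC1, oppr0, mul0r, addr0) rmorphN /= conjC1.
  by rewrite mulN1r normrN.
have d4 w : `|det (perp \o u) (perp \o v) w| = `|(w : plane R).2|.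
  rewrite /det /dot /= !(conjC0, conjC1, oppr0, mul0r, addr0) rmorphN /= conjC1.
  by rewrite mulN1r !normrN norm_conjC.
have n1 w : det u v w != 0 by rewrite -normr_eq0 d1 normr_eq0 generic2.
have n2 w : det u (perp \o v) w != 0.
  by rewrite -normr_eq0 d2 normr_eq0 generic1.
have n3 w : det (perp \o u) v w != 0.
  by rewrite -normr_eq0 d3 normr_eq0 generic1.
have n4 w : det (perp \o u) (perp \o v) w != 0.
  by rewrite -normr_eq0 d4 normr_eq0 generic2.
have s1 (e : R[i]) : 0 < e -> exists w, `|det u v w| <= e.
  by move=> /generic_snd_small[w we]; exists w; rewrite d1.
have s2 (e : R[i]) : 0 < e -> exists w, `|det u (perp \o v) w| <= e.
  by move=> /generic_fst_small[w we]; exists w; rewrite d2.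
have s3 (e : R[i]) : 0 < e -> exists w, `|det (perp \o u) v w| <= e.
  by move=> /generic_fst_small[w we]; exists w; rewrite d3.
have s4 (e : R[i]) : 0 < e -> exists w, `|det (perp \o u) (perp \o v) w| <= e.
  by move=> /generic_snd_small[w we]; exists w; rewrite d4.
(* Every complement and null space now comes from a [perp] field, so each claim is about one of the
   four pairs. *)
rewrite !subr_line_proj !null_space_line_proj.
split; [exact: projection_line_proj|exact: projection_line_proj|split..].
1-4: exact: range_line_proj_disjoint.
1-4: exact: closure_range_neqT.
all: exact: not_orthogonally_complemented.
Qed.
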